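(* Let $a_1a_2\cdots$ be a sequence in $\{0,1\}^\omega$ not ending in $(01)^\omega$, and let $$r=\sum_{k=1}^\infty\frac{2a_k}{(-4)^k}.$$ Then $$\partial\mathcal{K}\cap\Delta_{1,0,r}=\left\{r+\left(r-\tfrac25\right)i,\ r+\left(r+\tfrac35\right)i\right\},$$ and $\mathcal{K}\cap\Delta_{1,0,r}$ is the closed line segment $r+\left[r-\tfrac25,\,r+\tfrac35\right]i=\{r+ti : t\in\mathbb{R},\ r-\tfrac25\le t\le r+\tfrac35\}$.
   Context: Let $\alpha=-1+i$. The Knuth Twin Dragon is the compact set $\mathcal{K}=\left\{\sum_{k=1}^\infty d_k\alpha^{-k} : d_k\in\{0,1\}\right\}\subset\mathbb{C}$, and $\partial\mathcal{K}$ is its topological boundary in $\mathbb{C}$. For real $p,q,r$, $\Delta_{p,q,r}=\{x+iy\in\mathbb{C} : x,y\in\mathbb{R},\ px+qy=r\}$; thus $\Delta_{1,0,r}$ is the vertical line of complex numbers with real part $r$. A sequence ends in $(01)^\omega$ if some tail of it equals the periodic sequence $010101\cdots$ (i.e., it is eventually alternating between $0$ and $1$). *)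

(* Defs.v *)
From Stdlib Require Import Reals.
From Coquelicot Require Import Coquelicot.

Open Scope R_scope.

(* Digit sequences are [nat -> bool]; a sequence indexed from 1 in the text is
   indexed from 0 here, so that [d k] is the digit d_(k+1). *)
Definition digit (b : bool) : R := if b then 1 else 0.

Definition alpha : C := (RtoC (-1) + Ci)%C.

Definition twin_dragon (z : C) : Prop :=
  exists d : nat -> bool,
    is_series (fun k : nat => (RtoC (digit (d k)) / alpha ^ S k)%C) z.

(* Closure minus interior; [locally x P] says that P is a neighbourhood of x. *)
Definition boundary {T : UniformSpace} (D : T -> Prop) (x : T) : Prop :=
  (forall P : T -> Prop, locally x P -> exists y : T, P y /\ D y)
  /\ ~ locally x D.

Definition line (p q r : R) (z : C) : Prop := p * Re z + q * Im z = r.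

(* [Nat.odd] enumerates the periodic sequence 0, 1, 0, 1, ... *)
Definition ends_in_01 (a : nat -> bool) : Prop :=
  exists N : nat, forall n : nat, a (N + n)%nat = Nat.odd n.

(* Main.v *)
Require Import Defs.
From Stdlib Require Import Reals Lra Lia ClassicalEpsilon.
From Coquelicot Require Import Coquelicot.

(** Write K for the twin dragon and R(a) for the sum of the 2 a_k / (-4)^k.
    Since alpha^4 = -4, four steps of the expansion in base alpha amount to one
    step in base -4: z lies in K exactly when -4 z - (X + i Y) does for some
    block X + i Y of four digits, where X = 2 d1 - d3 + d4 and
    Y = 2 d1 - 2 d2 + d3.

    Sections.  Let z lie in K with Re z = R(a).  After n block steps the real
    part of the residual minus R of the n-fold shift of a is an integer, and it
    lies in [-1, 1] ([column_offset_le_1]).  Once it is 1 or -1, the offset is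
    forced to alternate between these values and a to alternate along with it
    ([extreme_offset_alternates]).  So if a does not end in 01 repeated, all
    offsets vanish, that is, every block has X = 2 a_k.  For such blocks
    Y - X ranges over {-2, -1, 0, 1}, and the numbers with an expansion in base
    -4 over these four digits form exactly the interval [-2/5, 3/5].  Hence
    Im z - R(a) lies in this interval ([column_height]), and conversely every
    value in it is attained ([column_filled]).

    Boundary.  K is closed, so its boundary on the line is part of the segment,
    and the endpoints are boundary points because the line leaves K there.  For
    the other points of the segment, the translates of K by Gaussian integers
    are used: they have dense union ([translates_dense]), so a point that lies
    in no translate but K itself is interior to K
    ([interior_of_unique_translate]).  If such a point z and its translate z - g
    both lie in K, the offset argument forces Re g = 0, and then g = 0 because
    the section has length 1 and z is not one of its ends ([column_interior]). *)

(** * Estimates in base -4 *)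

Lemma geometric_small (M q eps : R) :
  0 <= q < 1 -> 0 < eps -> exists n : nat, M * q ^ n < eps.
Proof.
  intros Hq Heps.
  assert (HM : 0 < Rabs M + 1) by (pose proof (Rabs_pos M); lra).
  destruct (pow_lt_1_zero q) with (y := eps / (Rabs M + 1)) as [N HN].
  - rewrite Rabs_pos_eq; lra.
  - now apply Rdiv_lt_0_compat.
  - exists N. specialize (HN N (le_n N)).
    pose proof (pow_le q N (proj1 Hq)) as Hp.
    rewrite Rabs_pos_eq in HN by assumption.
    apply Rlt_div_r in HN; [|lra].
    pose proof (Rle_abs M). nra.
Qed.

Lemma Rle_geometric (M x y : R) :
  (forall n : nat, x <= y + M * (/ 4) ^ n) -> x <= y.
Proof.
  intros H. apply Rnot_lt_le. intros Hlt.
  destruct (geometric_small M (/ 4) (x - y)) as [n Hn]; try lra.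
  specialize (H n). lra.
Qed.

(** The base is negative, so the largest value starts with the lowest digit and
    goes on with the smallest value: the bounds solve U = - (lo + L) / 4 and
    L = - (hi + U) / 4.  Each step divides the excess over these bounds by 4,
    hence a bounded set has no excess at all. *)
Lemma negative_base_bounds (S : R -> Prop) (M lo hi : R) :
  (forall x, S x -> Rabs x <= M) ->
  (forall x, S x -> exists c, lo <= c <= hi /\ S (-4 * x - c)) ->
  forall x, S x -> (lo - 4 * hi) / 15 <= x <= (hi - 4 * lo) / 15.
Proof.
  intros Hb Hs.
  set (L := (lo - 4 * hi) / 15). set (U := (hi - 4 * lo) / 15).
  set (B := M + Rabs L + Rabs U).
  assert (H : forall n x, S x ->
                L <= x + B * (/ 4) ^ n /\ x <= U + B * (/ 4) ^ n).
  { induction n as [|n IH]; intros x Hx.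
    - simpl. specialize (Hb x Hx). apply Rabs_le_between in Hb.
      unfold B. unfold Rabs. repeat destruct Rcase_abs; lra.
    - destruct (Hs x Hx) as [c [Hc Hx']].
      specialize (IH _ Hx'). simpl. unfold L, U in *. lra. }
  intros x Hx. split; apply (Rle_geometric B); intros n; apply (H n x Hx).
Qed.

(** * The modulus and the product topology of the plane *)

Lemma Ceq (z w : C) : Re z = Re w -> Im z = Im w -> z = w.
Proof. apply injective_projections. Qed.

Lemma im_le_Cmod (z : C) : Rabs (Im z) <= Cmod z.
Proof. eapply Rle_trans; [apply Rmax_r | apply Rmax_Cmod]. Qed.

Lemma Cmod_le_Re_Im (z : C) : Cmod z <= Rabs (Re z) + Rabs (Im z).
Proof.
  replace z with (RtoC (Re z) + RtoC (Im z) * Ci)%C at 1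
    by (apply Ceq; simpl; ring).
  eapply Rle_trans; [apply Cmod_triangle|].
  rewrite Cmod_mult, Cmod_Ci, !Cmod_R. lra.
Qed.

Lemma ball_Cmod (z w : C) (eps : R) :
  Cmod (w - z) < eps -> @ball C_UniformSpace z eps w.
Proof. apply C_NormedModule_mixin_compat1. Qed.

Lemma ball_coord (z w : C) (eps : R) :
  @ball C_UniformSpace z eps w ->
  Rabs (Re w - Re z) < eps /\ Rabs (Im w - Im z) < eps.
Proof. intros H; exact H. Qed.

Lemma Cmod_ball (z w : C) (eps : R) :
  @ball C_UniformSpace z eps w -> Cmod (z - w) < 2 * eps.
Proof.
  intros H. apply ball_coord in H.
  replace (z - w)%C with (- (w - z))%C by ring. rewrite Cmod_opp.
  eapply Rle_lt_trans; [apply Cmod_le_Re_Im|].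
  change (Rabs (Re w - Re z) + Rabs (Im w - Im z) < 2 * eps). lra.
Qed.

(** * The twin dragon as an invariant compact set *)

Lemma Cmod_alpha_sqr : Cmod alpha * Cmod alpha = 2.
Proof.
  pose proof (Cmod2_alt alpha) as H. simpl in H. lra.
Qed.

(** A rational stand-in for the square root of 2: all that matters below is that
    division by alpha contracts. *)
Lemma Cmod_alpha_lb : 4 / 3 <= Cmod alpha.
Proof.
  pose proof Cmod_alpha_sqr. pose proof (Cmod_ge_0 alpha). nra.
Qed.

Lemma alpha_neq_0 : alpha <> 0%C.
Proof. apply Cmod_gt_0. pose proof Cmod_alpha_lb. lra. Qed.

Lemma Cmod_div_alpha_pow (z : C) (n : nat) :
  Cmod (z / alpha ^ n) <= Cmod z * (3 / 4) ^ n.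
Proof.
  pose proof Cmod_alpha_lb.
  rewrite Cmod_div, Cmod_pow by (apply Cpow_nz, alpha_neq_0).
  unfold Rdiv at 1. rewrite <- pow_inv.
  apply Rmult_le_compat_l; [apply Cmod_ge_0|].
  apply pow_incr. split.
  - left. apply Rinv_0_lt_compat. lra.
  - replace (3 / 4) with (/ (4 / 3)) by field. apply Rinv_le_contravar; lra.
Qed.

Lemma Cmod_digit (b : bool) : Cmod (RtoC (digit b)) <= 1.
Proof.
  rewrite Cmod_R. destruct b; simpl; rewrite Rabs_pos_eq; lra.
Qed.

Definition digit_term (d : nat -> bool) (k : nat) : C :=
  (RtoC (digit (d k)) / alpha ^ S k)%C.

Lemma twin_dragon_bounded (z : C) :
  twin_dragon z -> Rabs (Re z) <= 5 /\ Rabs (Im z) <= 5.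
Proof.
  intros [d Hd].
  (* Partial sums are dominated by the geometric series of ratio 3/4. *)
  assert (Hs : forall n, Cmod (sum_n (digit_term d) n) <= 4 - 3 * (3 / 4) ^ n).
  { induction n as [|n IH].
    - rewrite sum_O. unfold digit_term.
      eapply Rle_trans; [apply Cmod_div_alpha_pow|].
      pose proof (Cmod_digit (d 0%nat)). simpl. lra.
    - rewrite sum_Sn.
      eapply Rle_trans; [apply Cmod_triangle|].
      pose proof (Cmod_div_alpha_pow (RtoC (digit (d (S n)))) (S (S n))) as Ht.
      pose proof (Cmod_digit (d (S n))).
      assert (0 <= (3 / 4) ^ n) by (apply pow_le; lra).
      change (Cmod (digit_term d (S n)) <=
        Cmod (RtoC (digit (d (S n)))) * (3 / 4) ^ S (S n)) in Ht.
      simpl in *. nra. }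
  destruct (Hd (@ball C_UniformSpace z 1)) as [N HN].
  { exists (mkposreal 1 Rlt_0_1). intros y Hy. exact Hy. }
  specialize (HN N (le_n N)). specialize (Hs N).
  change (sum_n _ N) with (sum_n (digit_term d) N) in HN.
  apply ball_coord in HN.
  pose proof (re_le_Cmod (sum_n (digit_term d) N)).
  pose proof (im_le_Cmod (sum_n (digit_term d) N)).
  assert (0 <= (3 / 4) ^ N) by (apply pow_le; lra).
  destruct HN.
  unfold Rabs in *. repeat destruct Rcase_abs; split; lra.
Qed.

Lemma twin_dragon_residual (z : C) :
  twin_dragon z -> exists b, twin_dragon (alpha * z - RtoC (digit b))%C.
Proof.
  intros [d Hd]. exists (d 0%nat), (fun k => d (S k)).
  pose proof alpha_neq_0.
  apply (is_series_ext (fun k => scal alpha (digit_term d (S k)))).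
  { intros k. unfold digit_term. change scal with Cmult.
    simpl. field. auto using Cpow_nz. }
  replace (alpha * z - RtoC (digit (d 0%nat)))%C
    with (scal alpha (z - digit_term d 0%nat)%C).
  - apply (@is_series_scal C_AbsRing C_NormedModule), is_series_incr_1.
    match goal with |- is_series _ ?x => replace x with z; [exact Hd|] end.
    change plus with Cplus. ring.
  - unfold digit_term. change scal with Cmult. simpl. field. auto.
Qed.

Lemma twin_dragon_extend (b : bool) (z : C) :
  twin_dragon z -> twin_dragon ((z + RtoC (digit b)) / alpha)%C.
Proof.
  intros [d Hd].
  exists (fun k => match k with O => b | S k => d k end).
  pose proof alpha_neq_0.
  apply is_series_decr_1.
  apply (is_series_ext (fun k => scal (/ alpha)%C (digit_term d k))).
  { intros k. unfold digit_term. change scal with Cmult.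
    simpl. field. auto using Cpow_nz. }
  match goal with |- is_series _ ?x => replace x with (scal (/ alpha)%C z) end.
  - now apply (@is_series_scal C_AbsRing C_NormedModule).
  - change (/ alpha * z = (z + RtoC (digit b)) / alpha
              + - (RtoC (digit b) / (alpha * 1)))%C.
    field. auto.
Qed.

Lemma twin_dragon_0 : twin_dragon 0%C.
Proof.
  exists (fun _ => false).
  apply (is_series_ext (fun _ => zero)).
  - intros k. change (RtoC 0 = RtoC 0 * / alpha ^ S k)%C. ring.
  - intros P HP. exists 0%nat. intros n _. unfold filtermap.
    replace (sum_n _ n) with (RtoC 0); [now apply locally_singleton|].
    induction n as [|n IH]; [now rewrite sum_O|].
    rewrite sum_Sn, <- IH. change (RtoC 0 = RtoC 0 + RtoC 0)%C. ring.
Qed.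

(** K is the largest bounded set that every point can stay in forever under the
    maps z -> alpha z - d.  The digits chosen along such an orbit form an
    expansion of z, because the error after n digits is the n-th residual
    divided by alpha^n. *)
Lemma bounded_residuals_twin_dragon (S : C -> Prop) (M : R) :
  (forall z, S z -> Cmod z <= M) ->
  (forall z, S z -> exists b, S (alpha * z - RtoC (digit b))%C) ->
  forall z, S z -> twin_dragon z.
Proof.
  intros Hb Hs z Hz.
  assert (Hf : forall w, exists b, S w -> S (alpha * w - RtoC (digit b))%C).
  { intros w. destruct (classic (S w)) as [Hw|Hw].
    - destruct (Hs w Hw) as [b Hw']. now exists b.
    - exists true. tauto. }
  set (f := fun w => epsilon (inhabits true)
                       (fun b => S w -> S (alpha * w - RtoC (digit b))%C)).
  assert (Hf' : forall w, S w -> S (alpha * w - RtoC (digit (f w)))%C).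
  { intros w. exact (epsilon_spec (inhabits true) _ (Hf w)). }
  set (res := fix res n := match n with
                           | O => z
                           | Datatypes.S n =>
                               (alpha * res n - RtoC (digit (f (res n))))%C
                           end).
  assert (Hres : forall n, S (res n)) by (induction n; simpl; auto).
  pose proof alpha_neq_0 as Ha.
  exists (fun n => f (res n)).
  assert (Hsum : forall n,
    sum_n (digit_term (fun n => f (res n))) n
      = (z - res (Datatypes.S n) / alpha ^ Datatypes.S n)%C).
  { induction n as [|n IH].
    - rewrite sum_O.
      change (digit_term (fun n => f (res n)) 0
              = z - (alpha * z - RtoC (digit (f z))) / (alpha * 1))%C.
      unfold digit_term. simpl. field. auto.
    - rewrite sum_Sn, IH.
      match goal with |- ?x = ?y => change (@eq C x y) end.
      change plus with Cplus. unfold digit_term.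
      change (res (Datatypes.S (Datatypes.S n))) with
        (alpha * res (Datatypes.S n)
         - RtoC (digit (f (res (Datatypes.S n)))))%C.
      generalize (res (Datatypes.S n)). intros w. simpl.
      field. auto using Cpow_nz. }
  intros P [eps HP].
  destruct (geometric_small M (3 / 4) eps) as [N HN]; [lra|apply cond_pos|].
  exists N. intros n Hn. apply HP, ball_Cmod.
  change (sum_n _ n) with (sum_n (digit_term (fun n => f (res n))) n).
  rewrite Hsum.
  match goal with |- Cmod ?x < _ => replace x with
    (- (res (Datatypes.S n) / alpha ^ Datatypes.S n))%C by ring end.
  rewrite Cmod_opp. eapply Rle_lt_trans; [apply Cmod_div_alpha_pow|].
  eapply Rle_lt_trans; [|exact HN].
  apply Rmult_le_compat; [apply Cmod_ge_0|apply pow_le; lra|now apply Hb|].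
  rewrite <- (Rmult_1_r ((3 / 4) ^ N)).
  replace (Datatypes.S n) with (N + (Datatypes.S n - N))%nat by lia.
  rewrite pow_add. apply Rmult_le_compat_l; [apply pow_le; lra|].
  rewrite <- (pow1 (Datatypes.S n - N)). apply pow_incr. lra.
Qed.

Lemma twin_dragon_Cmod (z : C) : twin_dragon z -> Cmod z <= 10.
Proof.
  intros H. apply twin_dragon_bounded in H.
  pose proof (Cmod_le_Re_Im z). lra.
Qed.

(** The closure of K is bounded, and it inherits the invariance: if both
    candidates alpha z and alpha z - 1 were at positive distance from K, so would
    be z.  Digit by digit, this is the compactness of the set of expansions. *)
Lemma twin_dragon_closed (z : C) :
  (forall eps, 0 < eps -> exists w, twin_dragon w /\ Cmod (z - w) < eps) ->
  twin_dragon z.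
Proof.
  revert z.
  apply (bounded_residuals_twin_dragon _ 11).
  - intros z Hz. destruct (Hz 1 Rlt_0_1) as [w [Hw Hzw]].
    apply twin_dragon_Cmod in Hw.
    replace z with ((z - w) + w)%C by ring.
    eapply Rle_trans; [apply Cmod_triangle|lra].
  - intros z Hz.
    assert (Hd : forall eps, 0 < eps -> exists b w,
              twin_dragon w /\ Cmod (alpha * z - RtoC (digit b) - w) < eps).
    { intros eps Heps. pose proof Cmod_alpha_lb.
      destruct (Hz (eps / Cmod alpha)) as [w [Hw Hzw]].
      { apply Rdiv_lt_0_compat; lra. }
      destruct (twin_dragon_residual w Hw) as [b Hb].
      exists b. eexists. split; [exact Hb|].
      match goal with |- Cmod ?x < _ => replace x with
        (alpha * (z - w))%C by ring end.
      rewrite Cmod_mult. apply Rlt_div_r in Hzw; lra. }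
    apply NNPP. intros Hn.
    assert (Hb : forall b, exists eps, 0 < eps /\ forall w,
              twin_dragon w -> eps <= Cmod (alpha * z - RtoC (digit b) - w)).
    { intros b. apply NNPP. intros Hnb. apply Hn. exists b.
      intros eps Heps. apply NNPP. intros Hne. apply Hnb.
      exists eps. split; [assumption|]. intros w Hw.
      apply Rnot_lt_le. intros Hlt. apply Hne. now exists w. }
    destruct (Hb true) as [e1 [He1 H1]]. destruct (Hb false) as [e2 [He2 H2]].
    destruct (Hd (Rmin e1 e2)) as [b [w [Hw Hlt]]]; [now apply Rmin_pos|].
    pose proof (Rmin_l e1 e2). pose proof (Rmin_r e1 e2).
    destruct b; [specialize (H1 w Hw)|specialize (H2 w Hw)]; lra.
Qed.

(** * Four digits at a time *)

Lemma Re_residual (z w : C) : Re (-4 * z - w) = -4 * Re z - Re w.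
Proof. unfold Re. simpl. ring. Qed.

Lemma Im_residual (z w : C) : Im (-4 * z - w) = -4 * Im z - Im w.
Proof. unfold Im. simpl. ring. Qed.

(** In coordinates, alpha^3 d1 + alpha^2 d2 + alpha d3 + d4. *)
Definition block (d1 d2 d3 d4 : bool) : C :=
  (2 * digit d1 - digit d3 + digit d4, 2 * digit d1 - 2 * digit d2 + digit d3).

Lemma twin_dragon_block (z : C) :
  twin_dragon z ->
  exists d1 d2 d3 d4, twin_dragon (-4 * z - block d1 d2 d3 d4)%C.
Proof.
  intros H.
  destruct (twin_dragon_residual _ H) as [d1 H1].
  destruct (twin_dragon_residual _ H1) as [d2 H2].
  destruct (twin_dragon_residual _ H2) as [d3 H3].
  destruct (twin_dragon_residual _ H3) as [d4 H4].
  exists d1, d2, d3, d4.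
  match goal with H : twin_dragon ?x |- twin_dragon ?y =>
    replace y with x; [exact H|] end.
  apply Ceq; simpl; ring.
Qed.

Lemma div_alpha (z : C) :
  (z / alpha)%C = ((Im z - Re z) / 2, - (Re z + Im z) / 2).
Proof. apply Ceq; unfold Re, Im; simpl; field. Qed.

Lemma twin_dragon_block_extend (d1 d2 d3 d4 : bool) (z : C) :
  twin_dragon z ->
  twin_dragon (- (z + block d1 d2 d3 d4) / 4)%C.
Proof.
  intros H.
  apply (twin_dragon_extend d4), (twin_dragon_extend d3),
    (twin_dragon_extend d2), (twin_dragon_extend d1) in H.
  match goal with H : twin_dragon ?x |- twin_dragon ?y =>
    replace y with x; [exact H|] end.
  rewrite !div_alpha. apply Ceq; simpl; field.
Qed.

(** * The abscissae R(a) *)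

Definition column_abscissa (a : nat -> bool) : R :=
  Series (fun k : nat => 2 * digit (a k) / (-4) ^ S k).

Definition shift (a : nat -> bool) (k : nat) : bool := a (S k).

Lemma column_term_bound (a : nat -> bool) (k : nat) :
  Rabs (2 * digit (a k) / (-4) ^ S k) <= / 2 * (/ 4) ^ k.
Proof.
  unfold Rdiv. rewrite Rabs_mult, <- pow_inv, <- RPow_abs.
  replace (Rabs (/ -4)) with (/ 4) by (rewrite Rabs_left; lra).
  assert (0 <= (/ 4) ^ k) by (apply pow_le; lra).
  simpl. rewrite Rabs_pos_eq; destruct (a k); simpl; lra.
Qed.

Lemma is_series_geom_4 : is_series (fun k => / 2 * (/ 4) ^ k) (/ 2 * / (1 - / 4)).
Proof.
  apply (is_series_scal_l (K := R_AbsRing) (V := R_NormedModule)), is_series_geom.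
  rewrite Rabs_pos_eq; lra.
Qed.

Lemma ex_series_abs_column (a : nat -> bool) :
  ex_series (fun k : nat => Rabs (2 * digit (a k) / (-4) ^ S k)).
Proof.
  apply (@ex_series_le R_AbsRing R_CompleteNormedModule _ (fun k => / 2 * (/ 4) ^ k)).
  - intros n. change norm with Rabs. rewrite Rabs_Rabsolu. apply column_term_bound.
  - eexists. apply is_series_geom_4.
Qed.

Lemma column_abscissa_bounded (a : nat -> bool) : Rabs (column_abscissa a) <= 1.
Proof.
  eapply Rle_trans; [apply Series_Rabs, ex_series_abs_column|].
  eapply Rle_trans.
  - apply (Series_le _ (fun k => / 2 * (/ 4) ^ k)).
    + intros n. split; [apply Rabs_pos|apply column_term_bound].
    + eexists. apply is_series_geom_4.
  - rewrite (is_series_unique _ _ is_series_geom_4). lra.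
Qed.

Lemma column_abscissa_shift (a : nat -> bool) :
  column_abscissa (shift a) = -4 * column_abscissa a - 2 * digit (a 0%nat).
Proof.
  unfold column_abscissa.
  rewrite (Series_incr_1 (fun k => 2 * digit (a k) / (-4) ^ S k))
    by apply ex_series_Rabs, ex_series_abs_column.
  rewrite (Series_ext (fun k => 2 * digit (shift a k) / (-4) ^ S k)
             (fun k => -4 * (2 * digit (a (S k)) / (-4) ^ S (S k)))).
  - rewrite Series_scal_l. simpl. field.
  - intros n. unfold shift. simpl. field. apply pow_nonzero. lra.
Qed.

Lemma shift_not_ends_in_01 (a : nat -> bool) :
  ~ ends_in_01 a -> ~ ends_in_01 (shift a).
Proof.
  intros H [N HN]. apply H. exists (S N). exact HN.
Qed.

(** * Vertical sections *)

(** The offset has an expansion in base -4 with digits X - 2 a_k between -3 and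
    3, and 3 + 4 * 3 = 15. *)
Lemma column_offset_le_1 (z : C) (a : nat -> bool) :
  twin_dragon z -> -1 <= Re z - column_abscissa a <= 1.
Proof.
  intros Hz.
  assert (H : (-3 - 4 * 3) / 15 <= Re z - column_abscissa a <= (3 - 4 * -3) / 15).
  { apply (negative_base_bounds (fun x => exists z a, twin_dragon z /\
             x = Re z - column_abscissa a) 6).
    - intros x [w [b [Hw ->]]]. apply twin_dragon_bounded in Hw.
      pose proof (column_abscissa_bounded b) as Hb.
      destruct Hw as [Hw _].
      unfold Rabs in *. repeat destruct Rcase_abs; lra.
    - intros x [w [b [Hw ->]]].
      destruct (twin_dragon_block w Hw) as (d1 & d2 & d3 & d4 & Hd).
      exists (Re (block d1 d2 d3 d4) - 2 * digit (b 0%nat)). split.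
      + destruct d1, d3, d4, (b 0%nat); simpl; lra.
      + eexists _, (shift b). split; [exact Hd|].
        rewrite column_abscissa_shift, Re_residual. ring.
    - now exists z, a. }
  lra.
Qed.

(** An offset e is followed by -4 e - (X - 2 a_0).  If e = -1, the new offset is
    at most 1 only when X = 3 and a_0 = 0, and then it equals 1; symmetrically
    e = 1 forces X = -1, a_0 = 1 and the new offset -1. *)
Lemma extreme_offset_alternates (n : nat) :
  forall (z : C) (a : nat -> bool), twin_dragon z ->
    (Re z = column_abscissa a - 1 -> a n = Nat.odd n) /\
    (Re z = column_abscissa a + 1 -> a n = negb (Nat.odd n)).
Proof.
  induction n as [|n IH]; intros z a Hz;
    destruct (twin_dragon_block z Hz) as (d1 & d2 & d3 & d4 & Hd);
    pose proof (column_offset_le_1 _ (shift a) Hd) as Ho;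
    try specialize (IH _ (shift a) Hd);
    rewrite column_abscissa_shift, Re_residual in *;
    set (w := block d1 d2 d3 d4) in *;
    assert (Hw : -1 <= Re w <= 3) by
      (unfold w; destruct d1, d3, d4; simpl; lra).
  - split; intros He; simpl; destruct (a 0%nat); try reflexivity; simpl in *; lra.
  - destruct IH as [IH1 IH2].
    assert (Hi : Re w = -1 \/ Re w = 3 \/ 0 <= Re w <= 2)
      by (unfold w; destruct d1, d3, d4; simpl; lra).
    rewrite Nat.odd_succ, <- Nat.negb_odd, Bool.negb_involutive.
    split; intros He.
    + apply IH2. destruct (a 0%nat); simpl in *; lra.
    + apply IH1. destruct (a 0%nat); simpl in *; lra.
Qed.

Lemma integer_offset_zero (z : C) (a : nat -> bool) (e : Z) :
  ~ ends_in_01 a -> twin_dragon z -> Re z = column_abscissa a + IZR e -> e = 0%Z.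
Proof.
  intros Ha Hz He.
  pose proof (column_offset_le_1 z a Hz) as Ho.
  assert (-1 <= e <= 1)%Z as Hb by (split; apply le_IZR; lra).
  assert (e = 0 \/ e = -1 \/ e = 1)%Z as [->|[->| ->]] by lia; [easy| |];
    exfalso; apply Ha.
  - exists 0%nat. intros n. apply (extreme_offset_alternates n z a Hz). lra.
  - exists 1%nat. intros n.
    destruct (extreme_offset_alternates (1 + n) z a Hz) as [_ H].
    rewrite H by lra. change (1 + n)%nat with (S n).
    now rewrite Nat.odd_succ, <- Nat.negb_odd, Bool.negb_involutive.
Qed.

Lemma column_height (z : C) (a : nat -> bool) :
  ~ ends_in_01 a -> twin_dragon z -> Re z = column_abscissa a ->
  -2 / 5 <= Im z - column_abscissa a <= 3 / 5.
Proof.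
  intros Ha Hz Hre.
  assert (H : (-2 - 4 * 1) / 15 <= Im z - column_abscissa a <= (1 - 4 * -2) / 15).
  { apply (negative_base_bounds (fun t => exists z a, ~ ends_in_01 a /\
             twin_dragon z /\ Re z = column_abscissa a /\
             t = Im z - column_abscissa a) 6).
    - intros x (w & b & _ & Hw & _ & ->). apply twin_dragon_bounded in Hw.
      pose proof (column_abscissa_bounded b) as Hb.
      destruct Hw as [_ Hw].
      unfold Rabs in *. repeat destruct Rcase_abs; lra.
    - intros x (w & b & Hb & Hw & Hwb & ->).
      destruct (twin_dragon_block w Hw) as (d1 & d2 & d3 & d4 & Hd).
      (* The offset of the residual is again an integer, hence zero: this says
         that the real part of the block is 2 a_0. *)
      pose (zd := fun b : bool => if b then 1%Z else 0%Z).
      assert (Hzd : forall b, IZR (zd b) = digit b) by now intros [].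
      assert (HX : Re (block d1 d2 d3 d4) = 2 * digit (b 0%nat)).
      { pose proof (integer_offset_zero _ (shift b)
          (2 * zd (b 0%nat) - 2 * zd d1 + zd d3 - zd d4)
          (shift_not_ends_in_01 b Hb) Hd) as H.
        rewrite column_abscissa_shift, minus_IZR, plus_IZR, minus_IZR,
          !mult_IZR, !Hzd in H.
        assert (H0 : (2 * zd (b 0%nat) - 2 * zd d1 + zd d3 - zd d4 = 0)%Z)
          by (apply H; rewrite Re_residual, Hwb; simpl; ring).
        apply (f_equal IZR) in H0.
        rewrite minus_IZR, plus_IZR, minus_IZR, !mult_IZR, !Hzd in H0.
        simpl. lra. }
      (* If X is 0 or 2 then d3 = d4, so that Y - X = d3 - 2 d2. *)
      exists (Im (block d1 d2 d3 d4) - Re (block d1 d2 d3 d4)). split.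
      + revert HX. destruct d1, d2, d3, d4, (b 0%nat); simpl; lra.
      + eexists _, (shift b).
        split; [now apply shift_not_ends_in_01|].
        split; [exact Hd|].
        rewrite column_abscissa_shift.
        rewrite Re_residual, Im_residual. lra.
    - now exists z, a. }
  lra.
Qed.

(** The map t -> -4 t sends [-2/5, 3/5] onto an interval of length 4, which is
    the union of the translates of [-2/5, 3/5] by -2, -1, 0 and 1.  The digit
    c = d3 - 2 d2 is chosen by the translate that contains -4 t; the real part
    of the block is kept equal to 2 x by taking d1 = x and d4 = d3. *)
Lemma column_step (t : R) (x : bool) :
  -2 / 5 <= t <= 3 / 5 ->
  exists d1 d2 d3 d4, Re (block d1 d2 d3 d4) = 2 * digit x /\
    -2 / 5 <= -4 * t - (Im (block d1 d2 d3 d4) - 2 * digit x) <= 3 / 5.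
Proof.
  intros Ht.
  destruct (Rle_lt_dec (-4 * t) (-7 / 5));
    [|destruct (Rle_lt_dec (-4 * t) (-2 / 5));
      [|destruct (Rle_lt_dec (-4 * t) (3 / 5))]];
    [exists x, true, false, false | exists x, true, true, true
    |exists x, false, false, false | exists x, false, true, true];
    destruct x; simpl; lra.
Qed.

(** Iterating [column_step] n times and replacing the last residual by 0, a
    point of K, moves z by at most 3 / 4^n; K is closed. *)
Lemma column_filled (a : nat -> bool) (t : R) :
  -2 / 5 <= t <= 3 / 5 ->
  twin_dragon (column_abscissa a, column_abscissa a + t).
Proof.
  intros Ht.
  assert (H : forall n a t, -2 / 5 <= t <= 3 / 5 -> exists w, twin_dragon w /\
            Cmod ((column_abscissa a, column_abscissa a + t) - w)
              <= 3 * (/ 4) ^ n).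
  { clear a t Ht. induction n as [|n IH]; intros a t Ht.
    - exists 0%C. split; [apply twin_dragon_0|].
      eapply Rle_trans; [apply Cmod_le_Re_Im|]. unfold Re, Im. simpl.
      pose proof (column_abscissa_bounded a).
      unfold Rabs in *. repeat destruct Rcase_abs; lra.
    - destruct (column_step t (a 0%nat) Ht) as (d1 & d2 & d3 & d4 & Hre & Ht').
      destruct (IH (shift a) _ Ht') as [w [Hw Hn]].
      exists (- (w + block d1 d2 d3 d4) / 4)%C.
      split; [now apply twin_dragon_block_extend|].
      match type of Hn with Cmod ?y <= _ =>
        match goal with |- Cmod ?x <= _ =>
          replace x with (RtoC (- / 4) * y)%C end end.
      + rewrite Cmod_mult, Cmod_R, Rabs_left by lra.
        rewrite <- tech_pow_Rmult. lra.
      + rewrite column_abscissa_shift.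
        set (B := block d1 d2 d3 d4) in *. clearbody B.
        apply Ceq; unfold Re, Im in *; simpl; rewrite ?Hre; field. }
  apply twin_dragon_closed. intros eps Heps.
  destruct (geometric_small 3 (/ 4) eps) as [n Hn]; [lra|assumption|].
  destruct (H n a t Ht) as [w [Hw Hle]].
  exists w. split; [assumption|lra].
Qed.

(** * Translates of the twin dragon *)

Definition gaussian (m n : Z) : C := (IZR m, IZR n).

(** The norm of alpha is 2, and {0, 1} represents the residues modulo alpha: the
    digit is the parity of m + n. *)
Lemma gaussian_div_alpha (m n : Z) : exists (m' n' : Z) (b : bool),
  gaussian m n = (alpha * gaussian m' n' + RtoC (digit b))%C.
Proof.
  pose proof (Z.div_mod (m + n) 2 ltac:(lia)) as Hd.
  pose proof (Z.mod_pos_bound (m + n) 2 ltac:(lia)) as Hr.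
  set (q := ((m + n) / 2)%Z) in *.
  assert ((m + n) mod 2 = 0 \/ (m + n) mod 2 = 1)%Z as [H|H] by lia;
    rewrite H in Hd; clear H Hr; clearbody q;
    apply (f_equal IZR) in Hd; rewrite !plus_IZR, mult_IZR in Hd.
  - exists (n - q)%Z, (- q)%Z, false.
    unfold gaussian. rewrite minus_IZR, opp_IZR.
    apply Ceq; unfold Re, Im; simpl; lra.
  - exists (n - q)%Z, (- q)%Z, true.
    unfold gaussian. rewrite minus_IZR, opp_IZR.
    apply Ceq; unfold Re, Im; simpl; lra.
Qed.

(** A Gaussian quotient by alpha^k is the integral part plus k digits after the
    point, and a finite expansion lies in K. *)
Lemma translates_cover_lattice (k : nat) (m n : Z) : exists m' n' w,
  twin_dragon w /\ (gaussian m n / alpha ^ k)%C = (gaussian m' n' + w)%C.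
Proof.
  induction k as [|k IH].
  - exists m, n, 0%C. split; [apply twin_dragon_0|]. simpl. field.
  - destruct IH as (m' & n' & w & Hw & Heq).
    destruct (gaussian_div_alpha m' n') as (m1 & n1 & b & Hg).
    pose proof alpha_neq_0.
    exists m1, n1, ((w + RtoC (digit b)) / alpha)%C.
    split; [now apply twin_dragon_extend|].
    replace (gaussian m n / alpha ^ S k)%C
      with ((gaussian m n / alpha ^ k) / alpha)%C
      by (simpl; field; auto using Cpow_nz).
    rewrite Heq, Hg. field. auto.
Qed.

Lemma translates_dense (z : C) (eps : R) : 0 < eps -> exists m n w,
  twin_dragon w /\ Cmod (z - (gaussian m n + w)) < eps.
Proof.
  intros Heps.
  destruct (geometric_small 2 (3 / 4) eps) as [k Hk]; [lra|assumption|].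
  set (y := (alpha ^ k * z)%C).
  destruct (translates_cover_lattice k (up (Re y)) (up (Im y)))
    as (m & n & w & Hw & Heq).
  exists m, n, w. split; [assumption|]. rewrite <- Heq.
  pose proof alpha_neq_0.
  replace (z - gaussian (up (Re y)) (up (Im y)) / alpha ^ k)%C
    with ((y - gaussian (up (Re y)) (up (Im y))) / alpha ^ k)%C
    by (unfold y; field; auto using Cpow_nz).
  eapply Rle_lt_trans; [apply Cmod_div_alpha_pow|].
  eapply Rle_lt_trans; [|exact Hk].
  clear Heq. clearbody y. apply Rmult_le_compat_r; [apply pow_le; lra|].
  eapply Rle_trans; [apply Cmod_le_Re_Im|].
  unfold gaussian, Re, Im. simpl.
  pose proof (archimed (fst y)). pose proof (archimed (snd y)).
  unfold Rabs. repeat destruct Rcase_abs; lra.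
Qed.

(** A finite minimum, for families indexed by a bounded range of integers. *)
Lemma uniform_radius (P : Z -> R -> Prop) :
  (forall k e e', P k e -> e' <= e -> P k e') ->
  (forall k, exists e, 0 < e /\ P k e) ->
  forall N : nat, exists e, 0 < e /\
    forall k, (Z.abs k <= Z.of_nat N)%Z -> P k e.
Proof.
  intros Hm HP. induction N as [|N [e [He IH]]].
  - destruct (HP 0%Z) as [e [He H]]. exists e. split; [assumption|].
    intros k Hk. now replace k with 0%Z by lia.
  - destruct (HP (Z.of_nat (S N))) as [e1 [He1 H1]].
    destruct (HP (- Z.of_nat (S N))%Z) as [e2 [He2 H2]].
    exists (Rmin e (Rmin e1 e2)). split; [repeat apply Rmin_pos; assumption|].
    pose proof (Rmin_l e (Rmin e1 e2)). pose proof (Rmin_r e (Rmin e1 e2)).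
    pose proof (Rmin_l e1 e2). pose proof (Rmin_r e1 e2).
    intros k Hk.
    assert (k = Z.of_nat (S N) \/ k = - Z.of_nat (S N) \/
            Z.abs k <= Z.of_nat N)%Z as [->|[->|Hk']] by lia.
    + apply Hm with e1; [assumption|lra].
    + apply Hm with e2; [assumption|lra].
    + apply Hm with e; [auto|lra].
Qed.

(** Near z only finitely many translates matter, as K is bounded, and each one
    that misses z misses a neighbourhood of z, as K is closed.  So the dense
    union of the translates is, near z, contained in K, which is closed. *)
Lemma interior_of_unique_translate (z : C) :
  (forall m n, twin_dragon (z - gaussian m n) -> m = 0%Z /\ n = 0%Z) ->
  locally (T := C_UniformSpace) z twin_dragon.
Proof.
  intros Hz.
  set (avoids := fun m n e => (m = 0%Z /\ n = 0%Z) \/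
         forall w, Cmod (z - w) < e -> ~ twin_dragon (w - gaussian m n)).
  assert (Hm : forall m n e e', avoids m n e -> e' <= e -> avoids m n e').
  { intros m n e e' [H|H] Hle; [now left|right].
    intros w Hw. apply H. lra. }
  assert (HP : forall m n, exists e, 0 < e /\ avoids m n e).
  { intros m n. apply NNPP. intros Hne.
    assert (H0 : ~ (m = 0%Z /\ n = 0%Z)).
    { intros H0. apply Hne. exists 1. split; [lra|now left]. }
    apply H0, Hz, twin_dragon_closed.
    intros e He. apply NNPP. intros Hw. apply Hne.
    exists e. split; [assumption|right].
    intros w Hd Ht. apply Hw. eexists. split; [exact Ht|].
    now replace (z - gaussian m n - (w - gaussian m n))%C with (z - w)%C by ring. }
  (* A translation whose image of K comes within 1 of z has modulus at most
     |z| + 1 + 10, where 10 bounds K. *)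
  destruct (nfloor_ex (Cmod z + 12)) as [N [_ HN]].
  { pose proof (Cmod_ge_0 z). lra. }
  destruct (uniform_radius (fun m e => forall n,
              (Z.abs n <= Z.of_nat (S N))%Z -> avoids m n e)) with (N := S N)
    as [e [He Hav]].
  { intros m e e' H Hle n Hn. eauto. }
  { intros m. apply (uniform_radius (avoids m)); eauto. }
  assert (Hr : 0 < Rmin e 1 / 2) by (pose proof (Rmin_pos e 1 He Rlt_0_1); lra).
  pose proof (Rmin_l e 1). pose proof (Rmin_r e 1).
  exists (mkposreal _ (Rdiv_lt_0_compat _ 2 Hr Rlt_0_2)). intros w Hw.
  assert (Hzw : Cmod (z - w) < Rmin e 1 / 2)
    by (apply Cmod_ball in Hw; simpl in Hw; lra).
  apply twin_dragon_closed. intros eps Heps.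
  destruct (translates_dense w (Rmin eps (Rmin e 1 / 2))) as (m & n & v & Hv & Hwv).
  { now apply Rmin_pos. }
  pose proof (Rmin_l eps (Rmin e 1 / 2)). pose proof (Rmin_r eps (Rmin e 1 / 2)).
  assert (Hclose : Cmod (z - (gaussian m n + v)) < Rmin e 1).
  { replace (z - (gaussian m n + v))%C
      with ((z - w) + (w - (gaussian m n + v)))%C by ring.
    eapply Rle_lt_trans; [apply Cmod_triangle|lra]. }
  assert (Hg : Cmod (gaussian m n) <= Cmod z + 11).
  { replace (gaussian m n) with (z + (- (z - (gaussian m n + v)) + - v))%C by ring.
    eapply Rle_trans; [apply Cmod_triangle|].
    pose proof (Cmod_triangle (- (z - (gaussian m n + v))) (- v)) as Ht.
    rewrite !Cmod_opp in Ht. apply twin_dragon_Cmod in Hv. lra. }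
  assert (Hbound : forall k, Rabs (IZR k) <= Cmod z + 11 ->
                     (Z.abs k <= Z.of_nat (S N))%Z).
  { intros k Hk. apply le_IZR. rewrite abs_IZR, <- INR_IZR_INZ, S_INR. lra. }
  destruct (Hav m) with (n := n) as [[-> ->]|H'].
  - apply Hbound. pose proof (re_le_Cmod (gaussian m n)) as Hre. simpl in Hre. lra.
  - apply Hbound. pose proof (im_le_Cmod (gaussian m n)) as Him. simpl in Him. lra.
  - exists v. split; [assumption|].
    replace (gaussian 0 0 + v)%C with v in Hwv
      by (apply Ceq; unfold Re, Im; simpl; ring).
    lra.
  - exfalso. apply (H' (gaussian m n + v)%C); [lra|].
    now replace (gaussian m n + v - gaussian m n)%C with v by ring.
Qed.

(** If z - g lies in K, its abscissa is R(a) - Re g, an integer offset from R(a),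
    so Re g = 0; then z and z - g lie on the same section of length 1, whose ends
    differ from z, so Im g = 0 too. *)
Lemma column_interior (a : nat -> bool) (z : C) :
  ~ ends_in_01 a -> Re z = column_abscissa a ->
  -2 / 5 < Im z - column_abscissa a < 3 / 5 ->
  locally (T := C_UniformSpace) z twin_dragon.
Proof.
  intros Ha Hre Him. apply interior_of_unique_translate. intros m n Hd.
  assert (Hm : (- m)%Z = 0%Z).
  { apply (integer_offset_zero _ a _ Ha Hd). rewrite opp_IZR.
    simpl. fold (Re z). lra. }
  assert (m = 0)%Z as -> by lia. split; [reflexivity|].
  apply (column_height _ a Ha) in Hd; [|simpl; fold (Re z); lra].
  simpl in Hd. fold (Im z) in Hd.
  assert (-1 < n < 1)%Z by (split; apply lt_IZR; lra). lia.
Qed.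

(** * The section and its boundary *)

Lemma closure_twin_dragon (z : C) :
  (forall P : C -> Prop, locally (T := C_UniformSpace) z P ->
     exists y, P y /\ twin_dragon y) -> twin_dragon z.
Proof.
  intros H. apply twin_dragon_closed. intros eps Heps.
  assert (He2 : 0 < eps / 2) by lra.
  destruct (H (@ball C_UniformSpace z (eps / 2))) as [w [Hw Hd]].
  { exists (mkposreal _ He2). intros y Hy. exact Hy. }
  exists w. split; [assumption|]. apply Cmod_ball in Hw. lra.
Qed.

Lemma column_section (a : nat -> bool) (z : C) :
  ~ ends_in_01 a -> Re z = column_abscissa a ->
  (twin_dragon z <-> -2 / 5 <= Im z - column_abscissa a <= 3 / 5).
Proof.
  intros Ha Hre. split; intros H.
  - now apply column_height.
  - apply (column_filled a) in H.
    replace z with (column_abscissa a,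
      column_abscissa a + (Im z - column_abscissa a)); [assumption|].
    apply Ceq; simpl; fold (Re z); fold (Im z); lra.
Qed.

Lemma column_ends_not_interior (a : nat -> bool) (z : C) :
  ~ ends_in_01 a -> Re z = column_abscissa a ->
  locally (T := C_UniformSpace) z twin_dragon ->
  -2 / 5 < Im z - column_abscissa a < 3 / 5.
Proof.
  intros Ha Hre [eps Hl].
  pose proof (cond_pos eps) as Heps.
  assert (H : forall s, Rabs s <= eps / 2 ->
            -2 / 5 <= Im z + s - column_abscissa a <= 3 / 5).
  { intros s Hs.
    apply (column_section a (Re z, Im z + s) Ha); [exact Hre|].
    apply Hl, ball_Cmod. eapply Rle_lt_trans; [apply Cmod_le_Re_Im|].
    simpl. fold (Re z); fold (Im z).
    replace (Re z + - Re z) with 0 by ring.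
    replace (Im z + s + - Im z) with s by ring.
    rewrite Rabs_R0. lra. }
  pose proof (H (eps / 2)) as H1. pose proof (H (- (eps / 2))) as H2.
  rewrite Rabs_Ropp in H2. rewrite Rabs_pos_eq in H1, H2 by lra. lra.
Qed.

Theorem theorem3p1 (a : nat -> bool) (ha : ~ ends_in_01 a)
    (r : R) (hr : r = Series (fun k : nat => 2 * digit (a k) / (-4) ^ S k)) :
  (forall z : C,
     boundary twin_dragon z /\ line 1 0 r z <->
     z = (RtoC r + RtoC (r - 2 / 5) * Ci)%C \/
     z = (RtoC r + RtoC (r + 3 / 5) * Ci)%C) /\
  (forall z : C,
     twin_dragon z /\ line 1 0 r z <->
     exists t : R, r - 2 / 5 <= t <= r + 3 / 5 /\
       z = (RtoC r + RtoC t * Ci)%C).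
Proof.
  change (r = column_abscissa a) in hr.
  assert (Hline : forall z, line 1 0 r z <-> Re z = column_abscissa a).
  { intros z. unfold line. rewrite <- hr. split; lra. }
  assert (Hpt : forall z t, z = (RtoC r + RtoC t * Ci)%C <->
                  Re z = column_abscissa a /\ Im z = t).
  { intros z t. rewrite <- hr. split.
    - intros ->. simpl. split; ring.
    - intros [H1 H2]. apply Ceq; [rewrite H1|rewrite H2]; simpl; ring. }
  split; intros z; rewrite Hline.
  - rewrite !Hpt. split.
    + intros [[Hcl Hint] Hre].
      pose proof (closure_twin_dragon z Hcl) as Hz.
      apply (column_section a z ha Hre) in Hz.
      assert (~ (-2 / 5 < Im z - column_abscissa a < 3 / 5))
        by (intros H; apply Hint; now apply (column_interior a)).
      lra.
    + intros H.
      assert (Hre : Re z = column_abscissa a) by tauto.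
      split; [split|assumption].
      * intros P HP. exists z. split; [now apply locally_singleton|].
        apply (column_section a z ha Hre). lra.
      * intros Hl. apply (column_ends_not_interior a z ha Hre) in Hl. lra.
  - split.
    + intros [Hz Hre]. apply (column_section a z ha Hre) in Hz.
      exists (Im z). rewrite Hpt. split; [lra|tauto].
    + intros [t [Ht Hz]]. apply Hpt in Hz. destruct Hz as [Hre Him].
      split; [|assumption]. apply (column_section a z ha Hre). lra.
Qed.
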